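(* Let $0<q<1$, let $X, X_0, X_1, X_2,\ldots$ be almost surely non-negative i.i.d. random variables with $\mathbb{E}\log\max(X,1)<\infty$, and let $S=\sum_{n=0}^\infty q^n X_n$. Let $\mathbb{P}(X=0)=p_0>0$. Then $$-\log \mathbb{P}(S \leq \varepsilon) \sim \frac{\log (1/p_0)}{\log (1/q)} \,\log (1/\varepsilon),\qquad \text{as } \varepsilon\to 0.$$
   Context: Here $\varepsilon\to 0$ means $\varepsilon\downarrow 0$ through positive values, and $f\sim g$ means $\lim f/g=1$. In the degenerate case $p_0=1$ both sides of the asymptotic relation are identically zero, and the relation is understood to hold trivially. The condition $\mathbb{E}\log\max(X,1)<\infty$ is the necessary and sufficient condition for $S<\infty$ almost surely. *)

(* Defs.v *)
From HB Require Import structures.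
From mathcomp Require Export all_boot all_order all_algebra.
From mathcomp Require Export finmap.
From mathcomp Require Export all_classical all_reals all_analysis.
Export Order.TTheory GRing.Theory Num.Theory.
Export numFieldNormedType.Exports.

Set Implicit Arguments.
Unset Strict Implicit.
Unset Printing Implicit Defensive.

Local Open Scope classical_set_scope.
Local Open Scope ring_scope.

Section iid.
Context d (T : measurableType d) (R : realType) (P : probability T R).

(* Independence of the whole family, tested on Borel sets and on every finite
   subfamily. *)
Definition mutually_independent (Y : nat -> {RV P >-> R}) : Prop :=
  forall (J : {fset nat}) (B : nat -> set R),
    (forall j, j \in J -> measurable (B j)) ->
    P (\bigcap_(j in [set` J]) (Y j @^-1` B j)) =
      (\prod_(j <- J) P (Y j @^-1` B j))%E.

Definition identically_distributed (Y : nat -> {RV P >-> R}) : Prop :=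
  forall (i j : nat) (B : set R), measurable B ->
    distribution P (Y i) B = distribution P (Y j) B.

Definition iid (Y : nat -> {RV P >-> R}) : Prop :=
  mutually_independent Y /\ identically_distributed Y.

End iid.

(* The sequence X, Xs 0, Xs 1, ... *)
Definition prepend (A : Type) (X : A) (Xs : nat -> A) (n : nat) : A :=
  if n is m.+1 then Xs m else X.

(* S = \sum_n q ^ n X_n, as an extended real: no convergence is presupposed. *)
Definition discounted_sum (T : Type) (R : realType) (q : R) (X : nat -> T -> R)
    (w : T) : \bar R :=
  (\sum_(0 <= n <oo) (q ^+ n * X n w)%:E)%E.

(* f ~ g along F, i.e. f / g --> 1. Since x / 0 = 0, the first disjunct fails
   when g vanishes near F; the second one is the convention that 0 ~ 0, and is
   void when g is nonzero near a proper filter F. *)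
Definition asymp_equiv (R : realType) (F : set_system R) (f g : R -> R) : Prop :=
  (f x / g x @[x --> F] --> (1 : R)) \/
  (\forall x \near F, f x = 0 /\ g x = 0).

(* Main.v *)
Require Import Defs.
From mathcomp Require Import measurable_realfun.
From mathcomp Require Import lra ring.

(** The number of terms of the series that matter at scale [eps] is about
    [N = log (1 / eps) / log (1 / q)], since [q ^ N = eps]: for the sum to be of
    order [eps], essentially the first [N] variables have to vanish, which costs
    [p0 ^ N], while the rest of the series is of order [q ^ N] at no further
    exponential cost. So [P (S <= eps)] is about [p0 ^ N], as claimed.

    The upper bound ([discounted_sum_le_le_prob]) keeps only the constraints
    [X_n <= delta] for [n < N], where [eps <= delta * q ^ N]; their probability
    is [P (X <= delta) ^ N], and [P (X <= delta)] tends to [p0] as [delta]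
    decreases to [0] ([ex_prob_le_near_atom]).

    The lower bound ([discounted_sum_le_ge_prob]) exhibits an event of
    probability at least [p0 ^ N / 2] on which [S <= K * q ^ N]. After the first
    [N] terms, which vanish, the variables are only required to grow at most
    geometrically, [X_(N + i) <= r ^ (M + i)] with [1 < r < 1 / q]. The
    logarithmic moment makes the probabilities [P (X > r ^ m)] summable
    ([tail_sum_le_half]), so that for [M] large these infinitely many
    constraints hold with probability at least 1/2. Prescribing coordinatewise
    constraints in this way avoids any appeal to the law of the shifted series
    or to its independence from the first [N] terms.

    [asymp_equiv_power_bounds] converts the two bounds into the asymptotic
    equivalence. *)

Local Open Scope classical_set_scope.
Local Open Scope ring_scope.

(** * Measurability and comparison of events *)

(** A limit taken without presupposing convergence is still measurable: the
    points of convergence are those where the lower and upper limits agree,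
    which is a measurable set, and off that set [limn] is the constant
    [point]. This is what lets the events [S <= eps] be compared with other
    events although the terms of the series are only almost surely
    nonnegative. *)
Lemma measurable_fun_limn {R : realType} {d : measure_display}
    {T : measurableType d} (f : nat -> T -> \bar R) :
  (forall n, measurable_fun [set: T] (f n)) ->
  measurable_fun [set: T] (fun x => limn (f ^~ x)).
Proof.
move=> mf.
have mE : measurable_fun [set: T] (fun x => limn_einf (f ^~ x)).
  rewrite /limn_einf; apply: measurableT_comp => //.
  by apply: measurable_fun_limn_esup => n; exact: measurableT_comp.
have mS : measurable_fun [set: T] (fun x => limn_esup (f ^~ x)).
  exact: measurable_fun_limn_esup.
rewrite (_ : (fun _ => _) = (fun x =>
    if limn_einf (f ^~ x) == limn_esup (f ^~ x) then limn_esup (f ^~ x)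
    else point)); last first.
  apply/funext => x; case: (pselect (cvgn (f ^~ x))) => [cf|ncf].
    by rewrite is_cvg_limn_einfE// is_cvg_limn_esupE// eqxx.
  rewrite (dvgP ncf); case: eqP => // ES; exfalso; apply: ncf.
  apply/cvg_ex; exists (limn_esup (f ^~ x)).
  apply: (@squeeze_cvge _ _ _ _ (einfs (f ^~ x)) _ (esups (f ^~ x))).
  - apply: nearW => n; apply/andP; split.
      by apply: ereal_inf_lbound; exists n => /=.
    by apply: ereal_sup_ubound; exists n => /=.
  - by rewrite -ES limn_einf_lim; exact: is_cvg_einfs.
  - by rewrite limn_esup_lim; exact: is_cvg_esups.
by apply: measurable_fun_ifT => //; exact: measurable_fun_eqe.
Qed.

Lemma measurable_discounted_sum_le {R : realType} {d : measure_display}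
    {T : measurableType d} (q : R) (Xs : nat -> T -> R) (a : \bar R) :
  (forall n, measurable_fun [set: T] (Xs n)) ->
  measurable [set w | (discounted_sum q Xs w <= a)%E].
Proof.
move=> mX; rewrite -[X in measurable X]setTI.
apply: emeasurable_fun_infty_c => //; apply: measurable_fun_limn => n.
apply: emeasurable_sum => k; apply/measurable_EFinP.
exact: measurable_funM.
Qed.

Lemma ae_le_measure {R : realType} {d : measure_display} {T : measurableType d}
    {mu : {measure set T -> \bar R}} {A B : set T} :
  measurable A -> measurable B -> {ae mu, forall w, A w -> B w} ->
  (mu A <= mu B)%E.
Proof.
move=> mA mB [N [mN N0 hN]]; rewrite -(measureU0 mB mN N0).
apply: le_measure; rewrite ?inE//; first exact: measurableU.
move=> w Aw; case: (pselect (A w -> B w)) => [/(_ Aw)|nAB]; first by left.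
by right; exact: hN.
Qed.

(** * Independence and the upper bound *)

(** Independence of the family and equality of the laws, in the form used below:
    [X] itself only serves as the common law. *)
Lemma iid_bigcap {R : realType} {d : measure_display} {T : measurableType d}
    {P : probability T R} {X : {RV P >-> R}} {Xs : nat -> {RV P >-> R}}
    (hiid : iid (prepend X Xs)) {B : nat -> set R} (N : nat) :
  (forall n, measurable (B n)) ->
  P (\bigcap_(n in `I_N) (Xs n @^-1` B n)) =
    (\prod_(n < N) fine (P (X @^-1` B n)))%:E.
Proof.
move=> mB; have [hind hid] := hiid.
(* Index n of [Xs] is index n + 1 of the prepended family. *)
pose J := [fset n in iota 1 N]%fset.
pose B' n := B n.-1.
have := hind J B' (fun j _ => mB _).
rewrite (_ : \bigcap_(j in _) _ = \bigcap_(n in `I_N) (Xs n @^-1` B n)); last first.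
  apply/seteqP; split => w h n /=.
    by move=> nN; apply: (h n.+1); rewrite /= !inE mem_iota /= add1n.
  rewrite !inE mem_iota add1n; case: n => //= n nN; exact: h.
move=> ->.
rewrite (perm_big (iota 1 N)) /=; last first.
  apply: uniq_perm; rewrite ?iota_uniq ?fset_uniq// => x; by rewrite in_fset.
rewrite -[1%N]addn0 iotaDl big_map -[N in iota _ N]subn0 big_mkord -prodEFin.
apply: eq_bigr => n _ /=; rewrite fineK ?fin_num_measure//; last exact: measurable_funPTI.
exact: (hid n.+1 0%N _ (mB n)).
Qed.

(** The sum of nonnegative terms dominates each of them, so [S <= eps] forces
    [X_n <= eps / q ^ n <= delta] for all [n < N]. *)
Lemma discounted_sum_le_le_prob {R : realType} {d : measure_display}
    {T : measurableType d} {P : probability T R} (q : R) {X : {RV P >-> R}}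
    {Xs : nat -> {RV P >-> R}} (hiid : iid (prepend X Xs))
    (hXs0 : forall n : nat, {ae P, forall w, 0 <= Xs n w})
    (delta eps : R) (N : nat) :
  0 < q -> q < 1 -> 0 <= delta -> eps <= delta * q ^+ N ->
  fine (P [set w | (discounted_sum q Xs w <= eps%:E)%E]) <=
    fine (P (X @^-1` `]-oo, delta])) ^+ N.
Proof.
move=> q0 q1 d0 epsN.
have mS : measurable [set w | (discounted_sum q Xs w <= eps%:E)%E].
  by apply: measurable_discounted_sum_le => n; exact: measurable_funPT.
rewrite -lee_fin fineK ?fin_num_measure//.
rewrite -[N in X in (_ <= X)%E]card_ord -prodr_const.
rewrite -(iid_bigcap hiid (B := fun=> `]-oo, delta]%classic))//.
apply: ae_le_measure => //.
  by apply: bigcap_measurableType => // n _; exact: measurable_funPTI.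
apply: filterS (ae_foralln hXs0) => w X0 Sw n /= nN; rewrite in_itv /=.
have qn0 : 0 < q ^+ n by exact: exprn_gt0.
rewrite -(ler_pM2r qn0); apply: le_trans (_ : delta * q ^+ N <= _); last first.
  by rewrite ler_wpM2l// ler_wiXn2l ?ltW// ltnW.
apply: le_trans epsN; rewrite mulrC -lee_fin; apply: le_trans Sw.
have u0 k : (0 <= (q ^+ k * Xs k w)%:E)%E.
  by rewrite lee_fin mulr_ge0// exprn_ge0// ltW.
apply: le_trans (nneseries_lim_ge (m := 0) (P := xpredT) n.+1 (fun k _ _ => u0 k)).
by rewrite big_nat_recr//= leeDr// sume_ge0.
Qed.

(** * Tails under a logarithmic moment and the lower bound *)

(** The left side counts the integers [1 <= m <= n] below [y]. The bound by
    [n] is what the induction needs at the step where the new term counts. *)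
Lemma sum_indic_lt_le {R : realType} (y : R) (n : nat) : 0 <= y ->
  \sum_(m < n) ((m.+1%:R < y)%R : nat)%:R <= Num.min y n%:R.
Proof.
move=> y0; elim: n => [|n IH]; first by rewrite big_ord0 le_min lexx y0.
rewrite big_ord_recr /=; move: IH; rewrite !le_min => /andP[IHy IHn].
case: ltP => [ny|ny] /=.
- apply/andP; split; last by rewrite -[leRHS]natr1 lerD.
  by apply: le_trans (ltW ny); rewrite -[in leRHS]natr1 lerD.
- by rewrite addr0 IHy/=; apply: le_trans IHn _; rewrite ler_nat.
Qed.

(** The easy half of the layer-cake formula, by integrating the pointwise
    count of [sum_indic_lt_le]. *)
Lemma sum_tail_prob_le {R : realType} {d : measure_display}
    {T : measurableType d} (P : probability T R) (Y : T -> R) (n : nat) :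
  measurable_fun [set: T] Y -> (forall w, 0 <= Y w) ->
  (\sum_(m < n) P [set w | (m.+1%:R < Y w)%R] <= 'E_P[Y])%E.
Proof.
move=> mY Y0; rewrite expectation.unlock.
have mA m : measurable [set w | m.+1%:R < Y w].
  by rewrite -[X in measurable X]setTI -preimage_itvoy; exact: mY.
rewrite (eq_bigr (fun m : 'I_n =>
    (\int[P]_w (\1_[set w | m.+1%:R < Y w] w)%:E)%E)); last first.
  by move=> m _; rewrite integral_indic// setIT.
rewrite -ge0_integral_sum//; last first.
  by move=> m; apply/measurable_EFinP; exact: measurable_indic.
apply: ge0_le_integral => //.
- by move=> w _; apply: sume_ge0 => m _; rewrite lee_fin.
- by apply: emeasurable_sum => m; apply/measurable_EFinP; exact: measurable_indic.
- by exact/measurable_EFinP.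
move=> w _; rewrite sumEFin lee_fin.
have := sum_indic_lt_le (Y w) n (Y0 w); rewrite le_min => /andP[+ _].
apply: le_trans; apply: ler_sum => m _; rewrite indicE.
by rewrite (_ : (w \in _) = (m.+1%:R < Y w))//; apply/idP/idP; rewrite inE.
Qed.

(** The Weierstrass product inequality (a union bound). *)
Lemma prodr_ge_1Bsum {R : realDomainType} (n : nat) (F : nat -> R) :
  (forall i, 0 <= F i <= 1) ->
  1 - \sum_(i < n) (1 - F i) <= \prod_(i < n) F i.
Proof.
move=> F01; elim: n => [|n IH]; first by rewrite !big_ord0 subr0.
rewrite !big_ord_recr /=; have /andP[F0 F1] := F01 n.
have p0 : 0 <= \prod_(i < n) F i by apply: prodr_ge0 => i _; case/andP: (F01 i).
have p1 : \prod_(i < n) F i <= 1.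
  by apply: prodr_ile1 => i _; exact: F01.
nra.
Qed.

(** Passage from finitely many to all coordinates, by continuity from above. *)
Lemma iid_bigcap_ge {R : realType} {d : measure_display} {T : measurableType d}
    {P : probability T R} {X : {RV P >-> R}} {Xs : nat -> {RV P >-> R}}
    (hiid : iid (prepend X Xs)) {B : nat -> set R} {c : R} :
  (forall n, measurable (B n)) ->
  (forall k, c <= \prod_(n < k) fine (P (X @^-1` B n))) ->
  (c%:E <= P (\bigcap_n (Xs n @^-1` B n)))%E.
Proof.
move=> mB hc; pose A k := \bigcap_(n in `I_k) (Xs n @^-1` B n).
have mA k : measurable (A k).
  by apply: bigcap_measurableType => // n _; exact: measurable_funPTI.
rewrite (_ : \bigcap_n _ = \bigcap_k A k); last first.
  apply/seteqP; split=> w h; first by move=> k _ n _; exact: h.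
  by move=> n _; apply: (h n.+1) => //=.
have AP : P \o A @ \oo --> P (\bigcap_k A k).
  apply: nonincreasing_cvg_mu => //.
  - by rewrite ltey_eq fin_num_measure.
  - exact: bigcap_measurableType.
  - move=> m n mn; apply/subsetPset => w h k /= km; apply: h => /=.
    exact: leq_trans mn.
rewrite -(cvg_lim _ AP)//; apply: lime_ge; first by apply/cvg_ex; eexists; exact: AP.
by apply: nearW => k /=; rewrite /A (iid_bigcap hiid)// lee_fin.
Qed.

(** This is the only use of the logarithmic moment. With
    [Y = log (max X 1) / log r], the event [X > r ^ m] is [Y > m] for [m >= 1],
    so these events have summable probabilities because [Y] has finite
    expectation; the tails of a convergent series become small. *)
Lemma tail_sum_le_half {R : realType} {d : measure_display}
    {T : measurableType d} (P : probability T R) (X : {RV P >-> R}) (r : R) :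
  1 < r -> ('E_P[fun w => (ln (Num.max (X w) 1))%R] < +oo)%E ->
  exists M, forall n,
    \sum_(m < n) (1 - fine (P (X @^-1` `]-oo, r ^+ (M + m)]))) <= 2^-1.
Proof.
move=> r1 hlog; have lr0 : 0 < ln r by rewrite ln_gt0.
have r0 : 0 < r by exact: lt_trans r1.
pose Z w := ln (Num.max (X w) 1).
have mZ : measurable_fun [set: T] Z.
  apply: measurableT_comp; first exact: measurable_ln.
  exact: measurable_maxr.
have Z0 w : 0 <= Z w by rewrite ln_ge0// le_max lexx orbT.
pose Y w := (ln r)^-1 * Z w.
have mY : measurable_fun [set: T] Y by exact: measurable_funM.
have Y0 w : 0 <= Y w by rewrite mulr_ge0// invr_ge0 ltW.
have EY : ('E_P[Y] < +oo)%E.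
  move: hlog; rewrite !expectation.unlock => hlog.
  under eq_integral do rewrite EFinM.
  rewrite ge0_integralZl//; last 3 first.
  - exact/measurable_EFinP.
  - by move=> w _; rewrite lee_fin.
  - by rewrite lee_fin invr_ge0 ltW.
  by rewrite lte_mul_pinfty// lee_fin invr_ge0 ltW.
pose p m := P [set w | m.+1%:R < Y w].
have p0 m : true -> (0 <= p m)%E by [].
have pE m : p m = (1 - fine (P (X @^-1` `]-oo, r ^+ m.+1])))%:E.
  rewrite EFinB fineK ?fin_num_measure//; last exact: measurable_funPTI.
  rewrite -probability_setC; last exact: measurable_funPTI.
  rewrite preimage_setC setCitvl /p; congr (P _); apply/seteqP; split => w /=; rewrite in_itv/= andbT /Y.
  - rewrite mulrC ltr_pdivlMr// /Z mulrC mulr_natr -lnXn// ltr_ln ?posrE ?exprn_gt0//; last first.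
      by rewrite lt_max ltr01 orbT.
    by rewrite lt_max => /orP[//|]; rewrite ltNge exprn_ege1 ?ltW.
  - move=> rX; rewrite mulrC ltr_pdivlMr// /Z mulrC mulr_natr -lnXn//.
    rewrite ltr_ln ?posrE ?exprn_gt0 ?lt_max ?rX//.
    by rewrite ltr01 orbT.
have sp : (\sum_(0 <= m <oo) p m < +oo)%E.
  apply: le_lt_trans EY; apply: lime_le; first exact: is_cvg_ereal_nneg_natsum.
  by apply: nearW => n; rewrite big_mkord; exact: sum_tail_prob_le.
have [M hM] : exists M, (\sum_(M <= m <oo) p m <= (2^-1)%:E)%E.
  apply: contrapT => /forallNP hM.
  have hge : \forall M \near \oo, ((2^-1)%:E <= \sum_(M <= m <oo) p m)%E.
    by apply: nearW => M; rewrite ltW// ltNge; apply/negP; exact: hM.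
  have : ((2^-1)%:E <= 0 :> \bar R)%E.
    exact: cvge_ge hge (nneseries_tail_cvg sp p0).
  by rewrite lee_fin leNgt invr_gt0 ltr0n.
exists M.+1 => n; rewrite -lee_fin -sumEFin.
under eq_bigr => m _ do rewrite addSn -pE.
apply: le_trans hM; apply: le_trans (nneseries_lim_ge (M + n) _) => //.
rewrite -{2}(add0n M) big_addn addKn big_mkord.
by under [leRHS]eq_bigr do rewrite addnC.
Qed.

Lemma sum_geometric_le {R : realFieldType} (s : R) (n : nat) :
  0 <= s -> s < 1 -> \sum_(i < n) s ^+ i <= (1 - s)^-1.
Proof.
move=> s0 s1; rewrite -[leRHS]mul1r ler_pdivlMr ?subr_gt0// mulrC.
have := subrX1 s n; set S := \sum_(i < n) _ => e.
have := exprn_ge0 n s0; lra.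
Qed.

(** The event that the first [N] terms vanish and that afterwards
    [X_(N + i) <= s^-1 ^ (M + i)], where [s] is the square root of [q], has
    probability at least [p0 ^ N / 2]: the first [N] factors give [p0 ^ N], and
    the others lose at most the sum of the tail probabilities. On this event
    the series is at most [q ^ N * s^-1 ^ M * (1 + s + s ^ 2 + ...)], since
    [q ^ i * s^-1 ^ i = s ^ i]: growth at rate [s^-1] is slow enough to be
    absorbed by the discount and fast enough for the tails to be summable. *)
Lemma discounted_sum_le_ge_prob {R : realType} {d : measure_display}
    {T : measurableType d} {P : probability T R} (q p0 : R) {X : {RV P >-> R}}
    {Xs : nat -> {RV P >-> R}} (hiid : iid (prepend X Xs))
    (hXs0 : forall n : nat, {ae P, forall w, 0 <= Xs n w})
    (hlog : ('E_P[fun w => (ln (Num.max (X w) 1))%R] < +oo)%E)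
    (hp0 : P [set w | X w = 0] = p0%:E) :
  0 < q -> q < 1 -> 0 < p0 ->
  exists2 K : R, 0 < K & forall N eps, K * q ^+ N <= eps ->
    2^-1 * p0 ^+ N <=
    fine (P [set w | (discounted_sum q Xs w <= eps%:E)%E]).
Proof.
move=> q0 q1 p0_gt0; pose s := Num.sqrt q.
have s0 : 0 < s by rewrite sqrtr_gt0.
have s1 : s < 1 by rewrite -sqrtr1 ltr_sqrt.
have sq : q = s ^+ 2 by rewrite sqr_sqrtr// ltW.
have r1 : 1 < s^-1 by rewrite invf_gt1.
have [M hM] := tail_sum_le_half P X s^-1 r1 hlog.
exists (s^-1 ^+ M * (1 - s)^-1).
  by rewrite mulr_gt0 ?invr_gt0 ?subr_gt0// exprn_gt0// invr_gt0.
move=> N eps hK.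
pose B n := if (n < N)%N then [set 0] else `]-oo, s^-1 ^+ (M + (n - N))]%classic.
have mB n : measurable (B n) by rewrite /B; case: ifP.
pose F n : R := fine (P (X @^-1` B n)).
have F01 n : 0 <= F n <= 1.
  rewrite fine_ge0//= -lee_fin fineK ?fin_num_measure//; last exact: measurable_funPTI.
  by apply: probability_le1; exact: measurable_funPTI.
have FN n : (n < N)%N -> F n = p0.
  by move=> nN; rewrite /F /B nN (_ : _ @^-1` _ = [set w | X w = 0]) // hp0.
have prodF k : 2^-1 * p0 ^+ N <= \prod_(n < k) F n.
(* Extra factors at most 1 only decrease the product, so all of the first
     [N] indices may be assumed present. *)
  apply: (@le_trans _ _ (\prod_(n < N + k) F n)); last first.
    rewrite addnC big_split_ord /= ler_piMr//.
      by apply: prodr_ge0 => i _; case/andP: (F01 i).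
    by apply: prodr_ile1.
  rewrite big_split_ord /= (eq_bigr (fun=> p0)) => [|i _]; last exact: FN.
  rewrite prodr_const card_ord mulrC ler_wpM2l ?exprn_ge0 ?(ltW p0_gt0)//.
  apply: le_trans (prodr_ge_1Bsum k (fun i => F (N + i)%N) _) => //.
  have := hM k.
  rewrite (eq_bigr (fun i : 'I_k => 1 - F (N + i)%N)) => [|i _]; first lra.
  by rewrite /F /B ltnNge leq_addr /= addKn.
have mS : measurable [set w | (discounted_sum q Xs w <= eps%:E)%E].
  by apply: measurable_discounted_sum_le => n; exact: measurable_funPT.
rewrite -lee_fin fineK ?fin_num_measure//.
apply: le_trans (iid_bigcap_ge hiid mB prodF) _.
apply: ae_le_measure => //.
  by apply: bigcap_measurableType => // n _; exact: measurable_funPTI.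
apply: filterS (ae_foralln hXs0) => w X0 XB /=.
have u0 k : (0 <= (q ^+ k * Xs k w)%:E)%E.
  by rewrite lee_fin mulr_ge0// exprn_ge0// ltW.
apply: lime_le; first exact: is_cvg_ereal_nneg_natsum.
apply: nearW => k; rewrite big_mkord.
(* Likewise, extra nonnegative terms only increase the partial sum. *)
apply: le_trans (_ : (\sum_(n < N + k) (q ^+ n * Xs n w)%:E <= _)%E).
  by rewrite addnC big_split_ord /= leeDl// sume_ge0.
rewrite sumEFin lee_fin; apply: le_trans hK.
rewrite big_split_ord /= big1 ?add0r => [|i _]; last first.
  by have := XB i I; rewrite /B /= ltn_ord /= => ->; rewrite mulr0.
have sN0 : s != 0 by rewrite gt_eqF.
apply: (@le_trans _ _ (\sum_(i < k) (s^-1 ^+ M * q ^+ N) * s ^+ i)); last first.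
  rewrite -mulr_sumr mulrAC ler_wpM2r ?exprn_ge0 ?(ltW q0)// ler_wpM2l//.
    by rewrite exprn_ge0// invr_ge0 ltW.
  by apply: sum_geometric_le => //; exact: ltW.
apply: ler_sum => i _.
have := XB (N + i)%N I; rewrite /B /= ltnNge leq_addr /= addKn in_itv /= => Xi.
apply: le_trans (ler_wpM2l _ Xi) _; first by rewrite exprn_ge0// ltW.
have -> : s ^+ i = q ^+ i * s^-1 ^+ i by rewrite -exprMn sq expr2 mulfK.
by rewrite !exprD mulrACA [q ^+ N * _]mulrC.
Qed.

(** * From power bounds to the asymptotic equivalence *)

(** Taking [N] closest to [log (1 / eps) / log (1 / q)] subject to the
    condition of the lower, respectively upper, power bound, that condition
    determines [N] up to a bounded error. With [g] the constant
    [log (1 / p0) / log (1 / q)], this turns the bounds into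
    [- ln G <= g * log (1 / eps) + O(1)] and, for every [h > 0],
    [- ln G >= (1 - h) * g * log (1 / eps) - O(1)]. *)
Lemma asymp_equiv_power_bounds {R : realType} (q p0 c K : R) (G : R -> R) :
  0 < q -> q < 1 -> 0 < p0 -> p0 < 1 -> 0 < c -> 0 < K ->
  (forall N eps, K * q ^+ N <= eps -> c * p0 ^+ N <= G eps) ->
  (forall phi, p0 < phi -> exists2 delta, 0 < delta &
     forall N eps, eps <= delta * q ^+ N -> G eps <= phi ^+ N) ->
  asymp_equiv 0^'+ (fun eps => - ln (G eps))
    (fun eps => ln (1 / p0) / ln (1 / q) * ln (1 / eps)).
Proof.
move=> q0 q1 p00 p01 c0 K0 lo up; left; apply/cvgrPdist_le => e e0.
rewrite !div1r !lnV ?posrE//.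
set A := - ln p0; set B := - ln q; set g := A / B.
have A0 : 0 < A by rewrite oppr_gt0 ln_lt0// p00.
have B0 : 0 < B by rewrite oppr_gt0 ln_lt0// q0.
have g0 : 0 < g by rewrite divr_gt0.
have gB : g * B = A by rewrite /g divfK// gt_eqF.
pose h := Num.min (e / 2) 1.
have h0 : 0 < h by rewrite lt_min ltr01 divr_gt0.
have [he h1] : h <= e / 2 /\ h <= 1 by rewrite !ge_min !lexx orbT.
(* [phi = p0 ^ (1 - h)], which exceeds [p0] because [p0 < 1]. *)
pose phi := expR (- ((1 - h) * A)).
have p0phi : p0 < phi.
  rewrite -[p0]lnK ?posrE// ltr_expR -[ln p0]opprK -/A; nra.
have [delta delta0 {}up] := up phi p0phi.
(* [D1] and [D2] bound the error terms of the upper and lower estimates of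
   [- ln (G eps)]; they become negligible once [l = - ln eps] is large. *)
pose D1 := g * ln K + A - ln c; pose D2 := (1 - h) * (A - g * ln delta).
near=> eps.
have eps0 : 0 < eps by [].
have epsd : eps <= delta by near: eps; exact: nbhs_right_le.
have epsK : eps <= K by near: eps; exact: nbhs_right_le.
rewrite div1r lnV ?posrE//; set l := - ln eps.
have l1 : 1 <= l.
  rewrite lerNr; near: eps; move/cvgrNyPle: (@lnNy R); exact.
have lD1 : D1 / (e * g) <= l.
  rewrite lerNr; near: eps; move/cvgrNyPle: (@lnNy R); exact.
have lD2 : D2 / (e / 2 * g) <= l.
  rewrite lerNr; near: eps; move/cvgrNyPle: (@lnNy R); exact.
have gl0 : 0 < g * l by rewrite mulr_gt0// (lt_le_trans ltr01).
rewrite ler_pdivrMr in lD1; last by rewrite mulr_gt0.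
rewrite ler_pdivrMr in lD2; last by rewrite !mulr_gt0// invr_gt0.
have lnle x y : 0 < x -> 0 < y -> (x <= y) = (ln x <= ln y).
  by move=> x0 y0; rewrite ler_ln.
(* The real numbers [x] and [y] solve [K * q ^ x = eps] and
   [delta * q ^ y = eps]; [x] is replaced by the next
   larger integer and [y] by its integer part. *)
pose x := (ln K + l) / B; pose y := (ln delta + l) / B.
have x0 : 0 <= x by rewrite divr_ge0 ?(ltW B0)// subr_ge0 -lnle.
have y0 : 0 <= y by rewrite divr_ge0 ?(ltW B0)// subr_ge0 -lnle.
have xB : x * B = ln K + l by rewrite divfK// gt_eqF.
have yB : y * B = ln delta + l by rewrite divfK// gt_eqF.
have /andP[N1x xN1] := truncn_itv x0; set n1 := Num.truncn x in N1x xN1.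
have /andP[N2y yN2] := truncn_itv y0; set n2 := Num.truncn y in N2y yN2.
have Glo : c * p0 ^+ n1.+1 <= G eps.
  apply: lo; rewrite lnle ?mulr_gt0 ?exprn_gt0// lnM ?posrE ?exprn_gt0// lnXn//.
  rewrite -mulr_natr -[ln q]opprK -/B -[ln eps]opprK -/l.
  by rewrite mulNr [B * _]mulrC lerBlDr addrC lerBrDr -xB ler_pM2r// ltW.
have Gup : G eps <= phi ^+ n2.
  apply: up; rewrite lnle ?mulr_gt0 ?exprn_gt0// lnM ?posrE ?exprn_gt0// lnXn//.
  rewrite -mulr_natr -[ln q]opprK -/B -[ln eps]opprK -/l.
  by rewrite mulNr [B * _]mulrC lerBrDr addrC lerBlDr -yB ler_pM2r.
have G0 : 0 < G eps by apply: lt_le_trans Glo; rewrite mulr_gt0// exprn_gt0.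
move: Glo; rewrite lnle ?mulr_gt0 ?exprn_gt0// lnM ?posrE ?exprn_gt0// lnXn//.
rewrite -mulr_natr -[ln p0]opprK -/A -natr1 => Glo.
move: Gup; rewrite lnle ?exprn_gt0 ?expR_gt0// lnXn ?expR_gt0// expRK -mulr_natr => Gup.
have xg : x * A = g * ln K + g * l by rewrite -gB mulrCA xB -mulrDr.
have yg : y * A = g * ln delta + g * l by rewrite -gB mulrCA yB -mulrDr.
set f := - ln (G eps).
have fup : f <= g * l + D1.
  have : n1%:R * A <= x * A by rewrite ler_pM2r.
  rewrite /D1 /f; lra.
have flo : (1 - h) * (g * l) - D2 <= f.
  have : (y - 1) * ((1 - h) * A) <= n2%:R * ((1 - h) * A).
    rewrite ler_wpM2r//; first by rewrite mulr_ge0 ?subr_ge0// ltW.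
    by rewrite lerBlDr natr1 ltW.
  have -> : (y - 1) * ((1 - h) * A) = (1 - h) * (y * A - A) by ring.
  rewrite yg /D2 /f; nra.
rewrite ler_distlC ler_pdivrMr// ler_pdivlMr//; apply/andP; split; nra.
Unshelve. all: by end_near. Qed.

(** By right continuity of the distribution function, whose value at [0] is the
    mass of the atom since [X] is almost surely nonnegative. *)
Lemma ex_prob_le_near_atom {R : realType} {d : measure_display}
    {T : measurableType d} {P : probability T R} {X : {RV P >-> R}} {p0 phi : R}
    (hX0 : {ae P, forall w, 0 <= X w}) (hp0 : P [set w | X w = 0] = p0%:E) :
  p0 < phi ->
  exists2 delta, 0 < delta & fine (P (X @^-1` `]-oo, delta])) <= phi.
Proof.
move=> p0phi; apply: contrapT => hn.
have cdf0 : (cdf X 0 <= p0%:E)%E.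
  rewrite -hp0; apply: (@ae_le_measure _ _ _ P (X @^-1` `]-oo, 0])).
    exact: measurable_funPTI.
    exact: (measurable_funPTI X (measurable_set1 0)).
  apply: filterS hX0 => w X0; rewrite /= in_itv/= => X0'.
  by apply/le_anti; rewrite X0' X0.
have hge : \forall r \near 0^'+, (phi%:E <= cdf X r)%E.
  near=> r; rewrite /cdf /distribution/= -[leRHS]fineK; last first.
    by rewrite fin_num_measure//; exact: measurable_funPTI.
  rewrite lee_fin leNgt; apply/negP => /ltW h; apply: hn; exists r => //.
have : (phi%:E <= cdf X 0)%E by exact: cvge_ge hge (@cdf_right_continuous _ _ _ P X 0).
by move=> /le_trans/(_ cdf0); rewrite lee_fin leNgt p0phi.
Unshelve. all: by end_near. Qed.

(** The degenerate case, where the sum vanishes almost surely. *)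
Lemma discounted_sum_prob_ae0 {R : realType} {d : measure_display}
    {T : measurableType d} {P : probability T R} {q : R} {X : {RV P >-> R}}
    {Xs : nat -> {RV P >-> R}} (hiid : iid (prepend X Xs))
    (hp0 : P [set w | X w = 0] = 1%E) (eps : R) :
  0 <= eps -> P [set w | (discounted_sum q Xs w <= eps%:E)%E] = 1%E.
Proof.
move=> eps0.
have mS : measurable [set w | (discounted_sum q Xs w <= eps%:E)%E].
  by apply: measurable_discounted_sum_le => n; exact: measurable_funPT.
apply/eqP; rewrite eq_le probability_le1//=.
have prod1 k : 1 <= \prod_(n < k) fine (P (X @^-1` [set 0])).
  by rewrite big1// => i _; rewrite (_ : _ @^-1` _ = [set w | X w = 0]) // hp0.
apply: le_trans (iid_bigcap_ge hiid (fun=> measurable_set1 0) prod1) _.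
apply: le_measure; rewrite ?inE//.
  by apply: bigcap_measurableType => // n _; exact: measurable_funPTI.
move=> w Xw0 /=; rewrite /discounted_sum eseries0// => n _ _.
by rewrite (Xw0 n I) mulr0.
Qed.

Theorem theorem2 (R : realType) (d : measure_display) (T : measurableType d)
    (P : probability T R) (q p0 : R)
    (X : {RV P >-> R}) (Xs : nat -> {RV P >-> R})
    (hq0 : 0 < q) (hq1 : q < 1)
    (hiid : iid (prepend X Xs))
    (hX0 : {ae P, forall w, 0 <= X w})
    (hXs0 : forall n : nat, {ae P, forall w, 0 <= Xs n w})
    (hlog : ('E_P[fun w => (ln (Num.max (X w) 1))%R] < +oo)%E)
    (hp0 : P [set w | X w = 0] = p0%:E)
    (hp0_gt0 : 0 < p0) :
  asymp_equiv 0^'+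
    (fun eps : R => - ln (fine (P [set w | (discounted_sum q Xs w <= eps%:E)%E])))
    (fun eps : R => ln (1 / p0) / ln (1 / q) * ln (1 / eps)).
Proof.
have p0_le1 : p0 <= 1.
  rewrite -lee_fin -hp0 probability_le1//.
  exact: (measurable_funPTI X (measurable_set1 0)).
(* If [p0 = 1], both sides vanish identically for [eps > 0]. *)
have [p0_lt1|p0_ge1] := ltP p0 1; last first.
  have p01 : p0 = 1 by apply/le_anti; rewrite p0_le1.
  right; near=> eps; rewrite (discounted_sum_prob_ae0 hiid)//; last by rewrite hp0 p01.
  by rewrite p01 divr1 ln1 oppr0 !mul0r.
have [K K0 lo] := discounted_sum_le_ge_prob q p0 hiid hXs0 hlog hp0 hq0 hq1 hp0_gt0.
apply: (asymp_equiv_power_bounds q p0 2^-1 K) => //.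
move=> phi p0phi; have [delta delta0 le_phi] := ex_prob_le_near_atom hX0 hp0 p0phi.
exists delta => // N eps epsN.
apply: le_trans (discounted_sum_le_le_prob _ hiid hXs0 _ _ _ hq0 hq1 (ltW delta0) epsN) _.
by rewrite lerXn2r ?nnegrE ?fine_ge0// (le_trans (ltW hp0_gt0))// ltW.
Unshelve. all: by end_near. Qed.
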